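(* $T(12,8,6) = 41$; equivalently, $\mathrm{ex}(12; K^{(6)}_8) = 924 - 41 = 883$.
   Context: For $n \ge \ell \ge k$, the Turán number $T(n,\ell,k)$ is the least number of $k$-subsets of an $n$-set such that every $\ell$-subset of the $n$-set contains at least one of them. $K^{(k)}_\ell$ denotes the complete $k$-uniform hypergraph on $\ell$ vertices, and $\mathrm{ex}(n; K^{(k)}_\ell)$ denotes the maximum number of edges of a $k$-uniform hypergraph on $n$ vertices containing no copy of $K^{(k)}_\ell$. *)

(* Defs.v *)
From mathcomp Require Import all_boot.

Set Implicit Arguments.
Unset Strict Implicit.
Unset Printing Implicit Defensive.

(* A hypergraph on a finite vertex type is identified with its set of edges. *)
Definition uniform (V : finType) (k : nat) (H : {set {set V}}) : bool :=
  [forall e in H, #|e| == k].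

Definition complete_hypergraph (k l : nat) : {set {set 'I_l}} :=
  [set e : {set 'I_l} | #|e| == k].

Definition turan_system (n l k : nat) (S : {set {set 'I_n}}) : bool :=
  uniform k S &&
  [forall L : {set 'I_n}, (#|L| == l) ==> [exists e in S, e \subset L]].

(* The family of all k-subsets only seeds the search; it is itself a Turan
   system as soon as k <= l, so that the arg min below is a genuine minimum. *)
Definition turan_number (n l k : nat) : nat :=
  #|[arg min_(S < complete_hypergraph k n | turan_system l k S) #|S|]|.

Definition contains_copy (W V : finType)
    (F : {set {set W}}) (H : {set {set V}}) : bool :=
  [exists f : {ffun W -> V}, injectiveb f && [forall e in F, f @: e \in H]].

(* The edgeless hypergraph is admissible whenever F has an edge, so that the
   maximum is then taken over a nonempty family. *)
Definition ex_number (n k : nat) (W : finType) (F : {set {set W}}) : nat :=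
  \max_(H : {set {set 'I_n}} | uniform k H && ~~ contains_copy F H) #|H|.

Lemma complete_turan_system n l k :
  k <= l -> turan_system l k (complete_hypergraph k n).
Proof.
move=> le_kl; apply/andP; split.
  by apply/forall_inP => e; rewrite inE.
apply/forallP => L; apply/implyP => /eqP cL.
have /set0Pn[e] : [set e : {set 'I_n} | (e \subset L) && (#|e| == k)] != set0.
  by rewrite -card_gt0 cards_draws cL bin_gt0.
by rewrite inE => /andP[sub ck]; apply/exists_inP; exists e; rewrite ?inE.
Qed.

Lemma turan_number_least n l k : k <= l ->
  (exists2 S : {set {set 'I_n}}, turan_system l k S & #|S| = turan_number n l k)
  /\ (forall S : {set {set 'I_n}}, turan_system l k S ->
        turan_number n l k <= #|S|).
Proof.
move=> /(complete_turan_system n) Hc; rewrite /turan_number.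
by case: arg_minnP => // S HS Smin; split; first exists S.
Qed.

(* Main.v *)
Require Import Defs.
From mathcomp Require Import all_boot.

(* Complementing the edges turns a Turan system into a family [B] of
   6-subsets of a 12-set covering every 4-subset; let [deg B A] be the number
   of members of [B] containing [A]. Counting flags bounds the degrees of
   triples, pairs, points and the empty set below by 3, 9, 20 and 40. The
   bound 9 for a pair is not a mere averaging: some point has degree 3
   together with the pair, so three blocks partition the other nine points
   into triples, and the remaining blocks through the pair must cover the 27
   pairs that are split by this partition, at most five at a time.

   If [B] had 40 members then all points would have degree 20, and every
   point would be in at most one pair of degree other than 9. The nine blocks
   through a pair of degree 9 form one of four configurations on the other
   ten points, which an exhaustive search finds; in each of them every triple
   has degree at most 4. In one of the four, all 4-sets containing the pair
   have degree 1 or 4; a count modulo 3 provides a 4-set of another degree,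
   hence a pair of degree 9 with one of the other three configurations. For
   each of these the linear inequalities on degrees are infeasible, by a
   Farkas certificate. *)

Set Implicit Arguments.
Unset Strict Implicit.
Unset Printing Implicit Defensive.

(** * Subsets of a labelled 12-set as bit sequences *)

Fixpoint words (n k : nat) : seq bitseq :=
  if n is n'.+1 then
    (if k is k'.+1 then map (cons true) (words n' k') else [::])
    ++ map (cons false) (words n' k)
  else if k is 0 then [:: [::]] else [::].

(* Here and in [any] and [every], [if] replaces [&&] and [||], which evaluate
   both arguments under call-by-value. *)
Fixpoint sub (a b : bitseq) : bool :=
  match a, b with
  | x :: a', y :: b' =>
      if x then (if y then sub a' b' else false) else sub a' b'
  | _, _ => true
  end.

Definition word (s : seq nat) : bitseq := [seq i \in s | i <- iota 0 12].

Fixpoint any (T : Type) (a : pred T) (s : seq T) : bool :=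
  if s is x :: s' then (if a x then true else any a s') else false.

Fixpoint every (T : Type) (a : pred T) (s : seq T) : bool :=
  if s is x :: s' then (if a x then every a s' else false) else true.

Definition relabel (s : seq nat) (w : bitseq) : bitseq :=
  [seq nth false w i | i <- s].

(* The labels of the pair of points through which blocks are enumerated. *)
Definition xy := word [:: 10; 11].

(** * Farkas certificates *)

(* Entry [(c, Ts)] gives the weight [c] to each label set in [Ts]. *)
Definition weights := seq (nat * seq (seq nat)).

(* The weights come from linear programming over the orbits of the automorphism
   groups of the configurations [D0], [D1] and [D2]. *)
Definition pos0 : weights := [::
  (1, [:: [:: 0; 1; 4; 7]; [:: 0; 1; 4; 9]; [:: 0; 1; 5; 7]; [:: 0; 2; 4; 9];
    [:: 0; 2; 5; 7]; [:: 0; 2; 5; 9]; [:: 1; 3; 4; 7]; [:: 1; 3; 4; 9];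
    [:: 1; 3; 5; 7]; [:: 1; 4; 6; 7]; [:: 1; 4; 6; 9]; [:: 1; 4; 7; 8];
    [:: 1; 4; 8; 9]; [:: 1; 5; 6; 7]; [:: 1; 5; 7; 8]; [:: 2; 3; 4; 9];
    [:: 2; 3; 5; 7]; [:: 2; 3; 5; 9]; [:: 2; 4; 6; 9]; [:: 2; 4; 8; 9];
    [:: 2; 5; 6; 7]; [:: 2; 5; 6; 9]; [:: 2; 5; 7; 8]; [:: 2; 5; 8; 9]]);
  (3, [:: [:: 1; 5; 9; 10]; [:: 1; 5; 9; 11]; [:: 2; 4; 7; 10];
    [:: 2; 4; 7; 11]]);
  (4, [:: [:: 1; 2; 4; 7]; [:: 1; 2; 5; 9]; [:: 1; 4; 5; 9]; [:: 1; 5; 7; 9];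
    [:: 2; 4; 5; 7]; [:: 2; 4; 7; 9]]);
  (7, [:: [:: 1; 2; 5; 10]; [:: 1; 2; 5; 11]; [:: 1; 2; 7; 10];
    [:: 1; 2; 7; 11]; [:: 1; 7; 9; 10]; [:: 1; 7; 9; 11];
    [:: 2; 4; 5; 10]; [:: 2; 4; 5; 11]; [:: 4; 5; 9; 10];
    [:: 4; 5; 9; 11]; [:: 4; 7; 9; 10]; [:: 4; 7; 9; 11]])].

Definition neg0 : weights := [::
  (10, [:: [:: 1; 2; 10]; [:: 1; 2; 11]; [:: 4; 5; 10]; [:: 4; 5; 11];
    [:: 7; 9; 10]; [:: 7; 9; 11]]);
  (3, [:: [:: 1; 5; 9]; [:: 2; 4; 7]]);
  (3, [:: [:: 1; 4; 7]; [:: 1; 4; 9]; [:: 1; 5; 7]; [:: 2; 4; 9];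
    [:: 2; 5; 7]; [:: 2; 5; 9]])].

Definition pos1 : weights := [::
  (1, [:: [:: 2; 7; 9; 10]; [:: 3; 7; 9; 10]])].

Definition neg1 : weights := [::
  (1, [:: [:: 2; 3; 10]; [:: 7; 9; 10]])].

Definition pos2 : weights := [::
  (4, [:: [:: 1; 4]; [:: 1; 6]; [:: 2; 4]; [:: 2; 6]; [:: 3; 4]; [:: 3; 6];
    [:: 4; 5]; [:: 5; 6]]);
  (4, [:: [:: 4; 6]]);
  (4, [:: [:: 0; 4; 6; 7]; [:: 0; 4; 6; 8]; [:: 0; 4; 6; 9]; [:: 4; 6; 7; 8];
    [:: 4; 6; 7; 9]; [:: 4; 6; 8; 9]]);
  (14, [:: [:: 1; 2; 4; 10]; [:: 1; 2; 4; 11]; [:: 1; 2; 6; 10];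
    [:: 1; 2; 6; 11]; [:: 1; 3; 4; 10]; [:: 1; 3; 4; 11];
    [:: 1; 3; 6; 10]; [:: 1; 3; 6; 11]; [:: 1; 4; 5; 10];
    [:: 1; 4; 5; 11]; [:: 1; 5; 6; 10]; [:: 1; 5; 6; 11];
    [:: 2; 3; 4; 10]; [:: 2; 3; 4; 11]; [:: 2; 3; 6; 10];
    [:: 2; 3; 6; 11]; [:: 2; 4; 5; 10]; [:: 2; 4; 5; 11];
    [:: 2; 5; 6; 10]; [:: 2; 5; 6; 11]; [:: 3; 4; 5; 10];
    [:: 3; 4; 5; 11]; [:: 3; 5; 6; 10]; [:: 3; 5; 6; 11]]);
  (9, [:: [:: 0]; [:: 7]; [:: 8]; [:: 9]]);
  (10, [:: [:: 0; 10]; [:: 0; 11]; [:: 7; 10]; [:: 7; 11]; [:: 8; 10];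
    [:: 8; 11]; [:: 9; 10]; [:: 9; 11]])].

Definition neg2 : weights := [::
  (9, [:: [:: 0; 7; 8]; [:: 0; 7; 9]; [:: 0; 8; 9]; [:: 7; 8; 9]]);
  (18, [:: [::]]);
  (8, [:: [:: 1; 2; 10]; [:: 1; 2; 11]; [:: 1; 3; 10]; [:: 1; 3; 11];
    [:: 1; 5; 10]; [:: 1; 5; 11]; [:: 2; 3; 10]; [:: 2; 3; 11];
    [:: 2; 5; 10]; [:: 2; 5; 11]; [:: 3; 5; 10]; [:: 3; 5; 11]]);
  (24, [:: [:: 4; 6; 10]; [:: 4; 6; 11]]);
  (22, [:: [:: 10]; [:: 11]]);
  (12, [:: [:: 4]; [:: 6]])].

Definition spread (f : weights) : seq (nat * bitseq) :=
  flatten [seq [seq (cT.1, word T) | T <- cT.2] | cT <- f].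

Definition weight (f : seq (nat * bitseq)) (w : bitseq) : nat :=
  foldr (fun cT s => if sub cT.2 w then cT.1 + s else s) 0 f.

(* Bounds for the degree of a [k]-set when there are 40 blocks; [upper 2] is a
   dummy value. *)
Definition lower (k : nat) := nth 0 [:: 40; 20; 9; 3; 1] k.

Definition upper (k : nat) := nth 0 [:: 40; 20; 0; 4] k.

Definition total (bound : nat -> nat) (f : seq (nat * bitseq)) : nat :=
  foldr (fun cT s => cT.1 * bound (count id cT.2) + s) 0 f.

(** [upper] bounds only sizes 0, 1 and 3, hence the restriction on [neg]. The last conjunct
    contradicts the degree bounds once the blocks [D] through the pair are accounted for exactly. *)
Definition certifies (D : seq bitseq) (pos neg : seq (nat * bitseq)) : bool :=
  [&& all (fun cT => has (fun k => cT.2 \in words 12 k) [:: 0; 1; 2; 3; 4]) pos,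
      all (fun cT => has (fun k => cT.2 \in words 12 k) [:: 0; 1; 3]) neg,
      all (fun w => if sub xy w then true else weight pos w <= weight neg w)
        (words 12 6)
    & total upper neg + sumn (map (weight pos) D) <
      total lower pos + sumn (map (weight neg) D)].

(** * The blocks through a pair of degree 9 *)

Definition link (s : seq (seq nat)) : seq bitseq :=
  [seq word (t ++ [:: 10; 11]) | t <- s].

(* With the configuration 0123 0456 0789 1457 1689 2345 2367 2389 4589, in which
   all pairs have degree 1 or 4, these are up to isomorphism the coverings of
   the pairs of a 10-set by nine 4-sets. *)
Definition D0 := link [::
  [:: 0; 1; 2; 3]; [:: 0; 4; 5; 6]; [:: 0; 7; 8; 9]; [:: 1; 2; 4; 9];
  [:: 1; 2; 6; 8]; [:: 1; 4; 5; 7]; [:: 2; 5; 7; 9]; [:: 3; 4; 5; 8];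
  [:: 3; 6; 7; 9]].
Definition D1 := link [::
  [:: 0; 1; 2; 3]; [:: 0; 4; 5; 6]; [:: 0; 7; 8; 9]; [:: 1; 4; 6; 8];
  [:: 1; 5; 7; 9]; [:: 2; 3; 4; 9]; [:: 2; 3; 5; 8]; [:: 2; 3; 6; 7];
  [:: 4; 6; 7; 9]].
Definition D2 := link [::
  [:: 0; 1; 2; 3]; [:: 0; 4; 5; 6]; [:: 0; 7; 8; 9]; [:: 1; 2; 5; 7];
  [:: 1; 3; 5; 8]; [:: 1; 4; 6; 9]; [:: 2; 3; 5; 9]; [:: 2; 4; 6; 8];
  [:: 3; 4; 6; 7]].

(** The three blocks through a triple of degree 3, whose points get the labels 0, 10 and 11. *)
Definition thirds := link [::
  [:: 0; 1; 2; 3]; [:: 0; 4; 5; 6]; [:: 0; 7; 8; 9]].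

(* The 27 pairs split by the partition 123, 456, 789, each with the labels 10
   and 11 added. *)
Definition cross : seq bitseq :=
  [seq t <- words 12 4 |
     [&& sub xy t, ~~ nth false t 0 & ~~ has (sub t) thirds]].

Definition candidates : seq bitseq :=
  [seq w <- words 12 6 | sub xy w && ~~ nth false w 0].

Definition gain (U : seq bitseq) (b : bitseq) := count (sub^~ b) U.

Definition perms3 := [:: [:: 0; 1; 2]; [:: 0; 2; 1]; [:: 1; 0; 2];
  [:: 1; 2; 0]; [:: 2; 0; 1]; [:: 2; 1; 0]].

(* The label permutations that fix 0, 10, 11 and respect the partition
   123, 456, 789. *)
Definition relabelings : seq (seq nat) :=
  let third i a := [seq (3 * i + j).+1 | j <- a] in
  [seq 0 :: third (nth 0 g 0) abc.1.1 ++ third (nth 0 g 1) abc.1.2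
          ++ third (nth 0 g 2) abc.2 ++ [:: 10; 11]
     | g <- perms3,
       abc <- [seq (ab, c) | ab <- [seq (a, b) | a <- perms3, b <- perms3],
                             c <- perms3]].

(* Some block covers five members of [cross]; [relabelings] moves it here. *)
Definition first_block := word [:: 1; 2; 4; 7; 10; 11].

Definition pairs := [seq t <- words 12 4 | sub xy t].

(** Label [i] stands for the triple formed by [i] and the pair. Inclusion in [D'] is enough of a
    test, as there are nine blocks on either side. *)
Definition leaf (ch : seq bitseq) : bool :=
  let D := thirds ++ ch in
  all (fun i => count (fun w => nth false w i) D <= 4) (iota 0 10) &&
  (all (fun t => count (sub t) D \in [:: 1; 4]) pairs ||
   any (fun s => let D' := map (relabel s) D in
                 any (every (fun d => any (pred1 d) D')) [:: D0; D1; D2])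
     relabelings).

(* [n] further blocks have to cover [U], and each covers at most [m] members. *)
Fixpoint search (m : nat) (lf : pred (seq bitseq)) (cands : seq bitseq)
    (n : nat) (ch U : seq bitseq) : bool :=
  if m * n < size U then true else
  match U, n with
  | [::], _ => (n == 0) && lf ch
  | t :: _, n'.+1 =>
      all (fun b => if sub t b then
                      search m lf cands n' (b :: ch) [seq u <- U | ~~ sub u b]
                    else true) cands
  | _, _ => true
  end.

(** * Soundness of the word lists, the search and the certificates *)

Lemma mem_words n k w : (w \in words n k) = (size w == n) && (count id w == k).
Proof.
elim: n k w => [|n IHn] k w; rewrite /words -?/words /=.
  by case: k w => [|k] [|x w].
rewrite mem_cat.
have memF x (s : seq bitseq) y v :
    (y :: v \in map (cons x) s) = (x == y) && (v \in s).
  apply/mapP/andP => [[u us [-> ->]]|[/eqP-> vs]]; last by exists v.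
  by rewrite eqxx us.
have mem0 x (s : seq bitseq) : ([::] \in map (cons x) s) = false by elim: s.
case: w => [|y w]; first by case: k => [|k]; rewrite ?mem0.
case: k => [|k]; rewrite !memF ?IHn; case: y => /=;
  by rewrite ?andbF ?orbF ?add1n ?eqSS.
Qed.

Lemma anyE (T : Type) (a : pred T) s : any a s = has a s.
Proof. by elim: s => //= x s ->; case: (a x). Qed.

Lemma everyE (T : Type) (a : pred T) s : every a s = all a s.
Proof. by elim: s => //= x s ->; case: (a x). Qed.

Lemma sum_count (T1 T2 : Type) (r : T1 -> T2 -> bool) s1 s2 :
  \sum_(x <- s1) count (r x) s2 = \sum_(y <- s2) count (r^~ y) s1.
Proof.
elim: s1 => [|x s1 IHs]; first by rewrite big_nil big1.
rewrite big_cons IHs /= big_split /=; congr (_ + _).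
by rewrite -sum1_count big_mkcond; apply: eq_bigr => y _; case: (r x y).
Qed.

(** Double counting of incidences; this justifies the pruning test of [search]. *)
Lemma cover_size (U rest : seq bitseq) m :
    all (fun t => has (sub t) rest) U ->
    all (fun b => gain U b <= m) rest ->
  size U <= m * size rest.
Proof.
move=> covU gain_le; rewrite -sum1_size.
apply: (@leq_trans (\sum_(t <- U) count (sub t) rest)).
  rewrite big_seq [leqRHS]big_seq; apply: leq_sum => t tU.
  by rewrite -has_count (allP covU).
rewrite sum_count.
apply: (@leq_trans (\sum_(b <- rest) m)).
  rewrite big_seq [leqRHS]big_seq; apply: leq_sum => b bR.
  exact: (allP gain_le).
by rewrite big_const_seq count_predT iter_addn_0.
Qed.

(** The first uncovered [t] lies in some [b] of [rest], so one branch follows [b]; the induction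
    goes on with [b] removed from [rest] and a smaller [U], on which gains can only drop. *)
Lemma search_complete m lf cands n ch U rest :
    search m lf cands n ch U -> all (fun b => gain U b <= m) cands ->
    size rest = n -> {subset rest <= cands} ->
    all (fun t => has (sub t) rest) U ->
  exists2 ch', perm_eq ch' (rest ++ ch) & lf ch'.
Proof.
elim: n ch U rest => [|n IHn] ch U rest /= + gainU szR candR covU.
  move/size0nil: szR covU candR => ->; case: U gainU => [|t U] // _ _ _.
  by rewrite muln0 /= => lfch; exists ch.
have -> /= : (m * n.+1 < size U) = false.
  apply/negbTE; rewrite -leqNgt -szR; apply: cover_size covU _.
  by apply/allP => b /candR; apply: (allP gainU).
case: U gainU covU => [|t U] // gainU covU /allP srch.
have /andP[/hasP[b bR tb] _] := covU.
move/(_ _ (candR b bR)): srch; rewrite tb => srch.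
have permR : perm_eq rest (b :: rem b rest) by exact: perm_to_rem.
have [||||ch' permC lf_ch'] := IHn _ _ (rem b rest) srch.
- apply/allP => c cC; apply: leq_trans (allP gainU c cC).
  by apply: leq_count_subseq; apply: filter_subseq.
- by rewrite size_rem // szR.
- by move=> c /mem_rem; apply: candR.
- apply/allP => u; rewrite mem_filter => /andP[ub /(allP covU)].
  by rewrite (eq_has_r (perm_mem permR)) /= (negbTE ub).
exists ch' => //; apply: perm_trans permC _.
rewrite perm_sym; apply: perm_trans (perm_cat permR (perm_refl ch)) _.
by rewrite cat_cons -cat1s (perm_catCA [:: b]).
Qed.

Lemma sum_weight f (X : seq bitseq) :
  \sum_(w <- X) weight f w = \sum_(cT <- f) cT.1 * count (sub cT.2) X.
Proof.
elim: f => [|[c T] f IHf]; first by rewrite big_nil big1.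
rewrite big_cons -IHf /= -sum1_count [X in _ = _ * X + _]big_mkcond big_distrr.
rewrite -big_split /=.
by apply: eq_bigr => w _; case: (sub T w); rewrite ?muln1 ?muln0.
Qed.

Lemma sum_total bound f :
  total bound f = \sum_(cT <- f) cT.1 * bound (count id cT.2).
Proof.
by elim: f => [|cT f IHf]; rewrite ?big_nil // big_cons -IHf.
Qed.

(* Weak duality: summing the weights over all blocks, those through [xy]
   contribute known amounts and every other one has [pos <= neg]. *)
Lemma certifies_infeasible X D pos neg :
    {subset X <= words 12 6} -> perm_eq [seq w <- X | sub xy w] D ->
    (forall k T, k \in [:: 0; 1; 2; 3; 4] -> T \in words 12 k ->
       lower k <= count (sub T) X) ->
    (forall k T, k \in [:: 0; 1; 3] -> T \in words 12 k ->
       count (sub T) X <= upper k) ->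
  ~~ certifies D pos neg.
Proof.
move=> XW permD lowX upX.
apply/negP => /and4P[/allP posW /allP negW /allP le_pn].
apply/negP; rewrite -leqNgt !sum_total !sumnE !big_map.
have posX : \sum_(cT <- pos) cT.1 * lower (count id cT.2) <=
    \sum_(w <- X) weight pos w.
  rewrite sum_weight big_seq [leqRHS]big_seq.
  apply: leq_sum => -[c T] /posW/hasP[k kP TW].
  rewrite leq_mul2l; apply/orP; right => /=.
  by move: (TW); rewrite mem_words => /andP[_ /eqP->]; apply: lowX.
have negX : \sum_(w <- X) weight neg w <=
    \sum_(cT <- neg) cT.1 * upper (count id cT.2).
  rewrite sum_weight big_seq [leqRHS]big_seq.
  apply: leq_sum => -[c T] /negW/hasP[k kP TW].
  rewrite leq_mul2l; apply/orP; right => /=.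
  by move: (TW); rewrite mem_words => /andP[_ /eqP->]; apply: upX.
have splitX f : \sum_(w <- X) weight f w =
    \sum_(w <- D) weight f w + \sum_(w <- X | ~~ sub xy w) weight f w.
  by rewrite (bigID (sub xy)) /= -(perm_big _ permD) big_filter.
apply: leq_trans (leq_add posX (leqnn _)) _.
apply: leq_trans (leq_add negX (leqnn _)).
rewrite !splitX addnC -[leqRHS]addnA leq_add2l [leqRHS]addnC leq_add2l.
rewrite big_seq_cond [leqRHS]big_seq_cond.
apply: leq_sum => w /andP[/XW/le_pn + /negbTE nxy].
by rewrite nxy.
Qed.

(** * Degrees and labellings *)

Section Labelling.

Variable V : finType.
Implicit Types (B : {set {set V}}) (A e : {set V}) (p : seq V) (w : bitseq).

Definition deg B A := #|[set e in B | A \subset e]|.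

Definition bits p A : bitseq := [seq x \in A | x <- p].

Definition lab p w : {set V} := [set x in mask w p].

Definition blocks p B : seq bitseq := [seq bits p e | e <- enum B].

Lemma sub_bits p w A : sub w (bits p A) = (lab p w \subset A).
Proof.
elim: p w => [|x p IHp] [|b w] //=; try by apply/esym/subsetP => y; rewrite inE.
case: b; rewrite IHp; last by apply: eq_subset => y; rewrite !inE.
case: ifPn => xA.
  apply/subsetP/subsetP => sA y; rewrite inE => yw.
    by move: yw; rewrite in_cons => /predU1P[->//|yw]; apply: sA; rewrite inE.
  by apply: sA; rewrite inE in_cons yw orbT.
apply/esym/negbTE/subsetPn; exists x => //.
by rewrite inE mem_head.
Qed.

Lemma count_blocks p B w : count (sub w) (blocks p B) = deg B (lab p w).
Proof.
rewrite count_map -sum1_count big_enum_cond sum1dep_card /deg.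
by apply: eq_card => e; rewrite !inE /= sub_bits.
Qed.

Lemma card_lab p w : uniq p -> size w = size p -> #|lab p w| = count id w.
Proof.
move=> Up sz; rewrite cardsE (card_uniqP _) ?size_mask //.
exact: mask_uniq.
Qed.

Lemma bitsK p A : (forall x, x \in p) -> lab p (bits p A) = A.
Proof.
by move=> pT; apply/setP => x; rewrite inE -filter_mask mem_filter pT andbT.
Qed.

Lemma count_bits p A : uniq p -> (forall x, x \in p) ->
  count id (bits p A) = #|A|.
Proof.
by move=> Up pT; rewrite -(bitsK A pT) card_lab ?size_map // bitsK.
Qed.

Lemma bits_relabel x0 p s A :
  {in s, forall i, i < size p} ->
  bits [seq nth x0 p i | i <- s] A = relabel s (bits p A).
Proof.
move=> ltsp; rewrite /bits -map_comp; apply/eq_in_map => i /ltsp ltip.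
by rewrite /= (nth_map x0).
Qed.

(** Each block through [A] has [k - #|A|] points outside [A]. *)
Lemma deg_sum B k A :
    {in B, forall e, #|e| = k} ->
  \sum_(v in ~: A) deg B (v |: A) = (k - #|A|) * deg B A.
Proof.
move=> cardB; rewrite mulnC.
transitivity (\sum_(v in ~: A) \sum_(e in B | A \subset e) (v \in e : nat)).
  apply: eq_bigr => v _; rewrite -big_mkcondr /= sum1dep_card /deg.
  by apply: eq_card => e; rewrite !inE subUset sub1set andbA andbAC.
rewrite exchange_big /deg -sum1dep_card big_distrl /=.
apply: eq_bigr => e /andP[eB Ae]; rewrite mul1n -big_mkcondr sum1dep_card.
rewrite -(cardB e eB) -cardsDS //; apply: eq_card => v.
by rewrite !inE.
Qed.

(** Turns a known total and a lower bound on the terms into an upper bound on the terms in [U]. *)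
Lemma sum_slack (A U : {set V}) (F : V -> nat) m : U \subset A ->
    (forall u, u \in A :\: U -> m <= F u) ->
  \sum_(u in U) F u + #|A :\: U| * m <= \sum_(u in A) F u.
Proof.
move=> /setIidPr UA le_m; rewrite [leqRHS](big_setID U) /= UA leq_add2l.
by rewrite -sum_nat_const; apply: leq_sum.
Qed.

End Labelling.

(** [sub] accepts as soon as one sequence ends, so the sizes have to agree. *)
Lemma sub_trans b a c : size a = size b -> size b = size c ->
  sub a b -> sub b c -> sub a c.
Proof.
elim: b a c => [|y b IHb] [|x a] [|z c] //= [sab] [sbc].
by case: x; case: y; case: z => //; apply: IHb.
Qed.

Definition xyz := word [:: 0; 10; 11].

Lemma sub_xyz w : size w = 12 -> sub xyz w = sub xy w && nth false w 0.
Proof. by case: w => [|[] w] //= _; rewrite ?andbT ?andbF. Qed.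

(** * Coverings of the 4-subsets of a 12-set by 6-subsets *)

Section Cover.

Variables (V : finType) (B : {set {set V}}).
Hypothesis cardV : #|V| = 12.
Hypothesis cardB : {in B, forall e : {set V}, #|e| = 6}.
Hypothesis coverB : forall Q : {set V}, #|Q| = 4 -> 0 < deg B Q.
Implicit Types (A Q e : {set V}) (p : seq V).

Lemma deg_lower A m :
  (forall v, v \notin A -> m <= deg B (v |: A)) ->
  (12 - #|A|) * m <= (6 - #|A|) * deg B A.
Proof.
move=> le_m; rewrite -(deg_sum A cardB) -cardV -[in leqLHS](setCK A).
rewrite -cardsCs -sum_nat_const.
by apply: leq_sum => v; rewrite inE => /le_m.
Qed.

Lemma deg_triple A : #|A| = 3 -> 3 <= deg B A.
Proof.
move=> cA; rewrite -(leq_pmul2l (isT : 0 < 3)).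
have := @deg_lower A 1; rewrite cA; apply=> v vA.
by apply: coverB; rewrite cardsU1 vA cA.
Qed.

(** Labels 10 and 11 mark the pair, 0 a point forming a triple of degree 3 with it, and the classes
    123, 456, 789 what the three blocks add to that triple. *)
Definition admissible p := [/\ uniq p, size p = 12 &
  perm_eq [seq w <- blocks p B | sub xyz w] thirds].

Lemma bits_const A e b : {in A, forall v, (v \in e) = b} ->
  bits (enum A) e = nseq #|A| b.
Proof.
move=> eA; rewrite cardE -(size_map (fun v => v \in e)).
apply/all_pred1P/allP => c /mapP[v]; rewrite mem_enum => /eA <- ->.
exact/eqP.
Qed.

Lemma labelling_exists x y : x != y -> deg B [set x; y] <= 9 ->
  exists2 p, admissible p & lab p xy = [set x; y].
Proof.
move=> nxy degxy.
have cxy : #|[set x; y]| = 2 by rewrite cards2 nxy.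
(* Ten triples of degree at least 4 would give [40 <= 4 * deg], hence degree at least 10. *)
have [z zxy degz] :
    exists2 z, z \notin [set x; y] & deg B (z |: [set x; y]) < 4.
  apply/exists_inP; apply: contraLR degxy => /exists_inPn big; rewrite -ltnNge.
  rewrite -(leq_pmul2l (isT : 0 < 4)).
  have := @deg_lower [set x; y] 4; rewrite cxy; apply=> v /big.
  by rewrite -leqNgt.
have cT : #|z |: [set x; y]| = 3 by rewrite cardsU1 zxy cxy.
set T := z |: [set x; y] in degz cT.
have degT : deg B T = 3 by apply/eqP; rewrite eqn_leq -ltnS degz deg_triple.
have deg_ge1 v : v \notin T -> 0 < deg B (v |: T).
  by move=> vT; apply: coverB; rewrite cardsU1 vT cT.
(* The nine 4-sets above [T] have degrees of sum [3 * 3], none of them zero. *)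
have deg1 v : v \notin T -> deg B (v |: T) = 1.
  move=> vT; apply/eqP; rewrite eqn_leq deg_ge1 // andbT.
  have := deg_sum T cardB; rewrite degT cT (bigD1 v) ?in_setC //=.
  suff: 8 <= \sum_(u in ~: T | u != v) deg B (u |: T).
    by move=> le8 /eqP; rewrite eqn_leq => /andP[/(leq_trans _) le9 _];
       rewrite -(leq_add2r 8); apply: le9; rewrite leq_add2l.
  have -> : 8 = #|~: T :\ v|.
    by move: (cardsD1 v (~: T)); rewrite inE vT cardsCs setCK cT cardV => -[].
  rewrite -sum1_card (eq_bigl (fun u => (u \in ~: T) && (u != v))).
    by apply: leq_sum => u /andP[+ _]; rewrite inE; apply: deg_ge1.
  by move=> u; rewrite !inE andbC.
pose E := [set e in B | T \subset e].
have : size (enum E) = 3 by rewrite -cardE.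
case enumE : (enum E) => [|e1 [|e2 [|e3 []]]] // _.
have memE e : (e \in E) = (e \in [:: e1; e2; e3]) by rewrite -enumE mem_enum.
have uniqE : uniq [:: e1; e2; e3] by rewrite -enumE enum_uniq.
have [n12 n13 n23] : [/\ e1 != e2, e1 != e3 & e2 != e3].
  by move: uniqE; rewrite /= !inE !negb_or andbT => /andP[/andP[]].
have TE e : e \in E -> T \subset e by rewrite inE => /andP[].
have cE e : e \in E -> #|e :\: T| = 3.
  by rewrite inE => /andP[eB Te]; rewrite cardsDS // cT cardB.
have sepE e e' u : e \in E -> e' \in E -> e != e' -> u \in e :\: T ->
    (u \in e') = false.
  move=> eE e'E ne /setDP[ue uT]; apply: contraTF (leqnn 1) => ue'.
  rewrite -ltnNge -[ltnRHS](deg1 u uT).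
  have -> : 2 = #|[set e; e']| by rewrite cards2 ne.
  apply: subset_leq_card; apply/subsetP => e''; rewrite !inE.
  by move: eE e'E; rewrite !inE => /andP[eB Te] /andP[e'B Te'] /orP[]/eqP->;
     rewrite ?eB ?e'B subUset sub1set ?ue ?ue'.
pose A1 := e1 :\: T; pose A2 := e2 :\: T; pose A3 := e3 :\: T.
pose s := enum A1 ++ enum A2 ++ enum A3.
have [E1 E2 E3] : [/\ e1 \in E, e2 \in E & e3 \in E].
  by rewrite !memE !inE !eqxx ?orbT.
have szs : size s = 9 by rewrite !size_cat -!cardE !cE.
pose p := z :: s ++ [:: x; y].
have szp : size p = 12 by rewrite /= size_cat szs.
have pT v : v \in p.
  rewrite inE mem_cat !inE; case vT: (v \in T).
    by move: vT; rewrite !inE => /or3P[]->; rewrite ?orbT.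
  have /card_gt0P[e] : 0 < deg B (v |: T) by apply: deg_ge1; rewrite vT.
  rewrite inE subUset sub1set => /and3P[eB ve Te].
  have : e \in E by rewrite inE eB.
  rewrite memE !mem_cat !mem_enum !in_setD vT !inE => /or3P[]/eqP<-.
  - by rewrite ve ?orbT.
  - by rewrite ve ?orbT.
  - by rewrite ve ?orbT.
have Up : uniq p.
  by apply: (leq_size_uniq (enum_uniq V)) => //; rewrite szp -cardE cardV.
have lab_outer b : lab p (b :: nseq 9 false ++ [:: true; true]) =
    (if b then T else [set x; y]).
  apply/setP => v.
  rewrite /lab inE /p mask_cons mask_cat ?size_nseq // mask_false.
  by case: b; rewrite !inE.
have labT : lab p xyz = T by rewrite -(lab_outer true).
exists p; last by rewrite -(lab_outer false).
split => //; rewrite /blocks filter_map.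
have -> : thirds = [:: bits p e1; bits p e2; bits p e3].
  have bitsp e b1 b2 b3 : e \in E ->
      {in A1, forall v, (v \in e) = b1} -> {in A2, forall v, (v \in e) = b2} ->
      {in A3, forall v, (v \in e) = b3} ->
      bits p e =
        true :: (nseq 3 b1 ++ nseq 3 b2 ++ nseq 3 b3) ++ [:: true; true].
    move=> /TE/subsetP Te b1P b2P b3P.
    rewrite /bits /= !map_cat -!/(bits _ e) (bits_const b1P) (bits_const b2P).
    by rewrite (bits_const b3P) !cE //= !Te ?inE ?eqxx ?orbT.
  have inA e : {in e :\: T, forall v, (v \in e) = true} by move=> v /setDP[].
  have [n21 n31 n32] : [/\ e2 != e1, e3 != e1 & e3 != e2].
    by split; rewrite eq_sym.
  rewrite (bitsp _ _ _ _ E1 (inA e1) (fun v => sepE _ _ v E2 E1 n21)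
                                     (fun v => sepE _ _ v E3 E1 n31)).
  rewrite (bitsp _ _ _ _ E2 (fun v => sepE _ _ v E1 E2 n12) (inA e2)
                                     (fun v => sepE _ _ v E3 E2 n32)).
  by rewrite (bitsp _ _ _ _ E3 (fun v => sepE _ _ v E1 E3 n13)
                            (fun v => sepE _ _ v E2 E3 n23) (inA e3)).
rewrite -[[:: bits p e1; _; _]]/(map (bits p) [:: e1; e2; e3]).
apply: perm_map; apply: uniq_perm => //.
  by rewrite filter_uniq // enum_uniq.
move=> e; rewrite -memE mem_filter mem_enum inE.
rewrite [X in X && _](_ : _ = (T \subset e)) 1?andbC //.
  by rewrite inE.
by rewrite -labT -sub_bits.
Qed.

Definition rest p := [seq w <- blocks p B | sub xy w && ~~ nth false w 0].

Lemma label_mem p : uniq p -> size p = 12 -> forall v, v \in p.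
Proof.
move=> Up szp v.
have [|_ ->] := uniq_min_size (s2 := enum V) Up (fun u _ => mem_enum _ u).
  by rewrite -cardE cardV szp.
exact: mem_enum.
Qed.

Lemma blocks_words p : uniq p -> size p = 12 ->
  {subset blocks p B <= words 12 6}.
Proof.
move=> Up szp w /mapP[e]; rewrite mem_enum => eB ->.
by rewrite mem_words size_map szp eqxx count_bits ?cardB //; apply: label_mem.
Qed.

Lemma blocks_size p w : size p = 12 -> w \in blocks p B -> size w = 12.
Proof. by move=> szp /mapP[e _ ->]; rewrite size_map. Qed.

(** * Blocks in an admissible labelling *)

Section Admissible.

Variable p : seq V.
Hypothesis adm : admissible p.

Let Up : uniq p. Proof. by case: adm. Qed.
Let szp : size p = 12. Proof. by case: adm. Qed.

Lemma blocks_xy : perm_eq [seq w <- blocks p B | sub xy w] (thirds ++ rest p).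
Proof.
case: adm => _ _; rewrite perm_sym => perm3.
rewrite perm_sym; apply: perm_trans (perm_cat perm3 (perm_refl _)) _.
rewrite perm_sym -(perm_filterC (nth false^~ 0) (filter _ _)) /= -!filter_predI.
apply: perm_cat; last first.
  rewrite (@eq_filter _ _ (fun w => sub xy w && ~~ nth false w 0)) //.
  by move=> w /=; rewrite andbC.
rewrite (@eq_in_filter _ _ (sub xyz)) // => w /(blocks_size szp) szw.
by rewrite sub_xyz //= andbC.
Qed.

Lemma rest_candidates : {subset rest p <= candidates}.
Proof.
move=> w; rewrite /candidates !mem_filter => /andP[-> wX].
exact: blocks_words wX.
Qed.

(** A block through 0 and the pair is one of [thirds], and these contain no member of [cross]; so
    the block covering such a member avoids 0. *)
Lemma rest_cover : all (fun t => has (sub t) (rest p)) cross.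
Proof.
apply/allP => t; rewrite /cross mem_filter mem_words => /andP[/and3P[xyt _ t3]].
case/andP=> /eqP szt /eqP ct.
have : has (sub t) (blocks p B).
  by rewrite has_count count_blocks coverB // card_lab ?szp ?szt.
case/hasP=> w wX tw; have szw := blocks_size szp wX.
have xyw : sub xy w by apply: sub_trans tw; rewrite // szt szw.
apply/hasP; exists w => //; rewrite mem_filter xyw wX andbT /=.
apply: contra t3 => w0; apply/hasP; exists w => //.
case: adm => _ _ /perm_mem <-.
by rewrite mem_filter sub_xyz // xyw w0.
Qed.

Lemma deg_xy : deg B (lab p xy) = 3 + size (rest p).
Proof.
rewrite -count_blocks -size_filter (perm_size blocks_xy) size_cat.
by congr (_ + _); vm_compute.
Qed.

(** Two of the four points that a block adds to the pair share one of the three classes, so at most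
    five of their six pairs are split. *)
Lemma gain_candidates : all (fun b => gain cross b <= 5) candidates.
Proof. by vm_compute. Qed.

Lemma size_cross : size cross = 27.
Proof. by vm_compute. Qed.

(** Five blocks would cover only 25 of the 27. *)
Lemma rest_ge6 : 5 < size (rest p).
Proof.
have := cover_size (m := 5) rest_cover; rewrite size_cross.
move=> /(_ _)/leq_trans le27; rewrite -(ltn_pmul2l (isT : 0 < 5)).
apply: (@leq_trans 27) => //; apply: le27 (leqnn _).
by apply/allP => b /rest_candidates; apply: (allP gain_candidates).
Qed.

(** Six blocks of gain at most 4 would cover only 24. *)
Lemma rest_big_gain : size (rest p) = 6 ->
  exists2 b, b \in rest p & gain cross b == 5.
Proof.
move=> sz6; apply/hasP; apply: contraTT (isT : 24 < 27) => /hasPn noBig.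
rewrite -leqNgt -size_cross -[24]/(4 * 6) -sz6.
apply: cover_size rest_cover _; apply/allP => b bR.
rewrite -ltnS ltn_neqAle noBig //.
by apply: (allP gain_candidates); apply: rest_candidates.
Qed.

End Admissible.

Lemma sub_nth a b i : size a = size b -> sub a b ->
  nth false a i -> nth false b i.
Proof.
elim: a b i => [|x a IHa] [|y b] [|i] //= [szab]; first by case: x; case: y.
by case: x; case: y => // ab; apply: IHa.
Qed.

Lemma sub_xyE w : size w = 12 -> sub xy w = nth false w 10 && nth false w 11.
Proof.
move: w; do 10!case=> [|? ] //; move=> w.
by case: w => [|[] [|[] [|? ?]]].
Qed.

Lemma lab_xyE x0 p : size p = 12 -> lab p xy = [set nth x0 p 10; nth x0 p 11].
Proof.
move: p; do 12!case=> [|? ] //; case=> // _.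
by apply/setP => v; rewrite !inE.
Qed.

Lemma relabelings_spec :
  all (fun s => [&& perm_eq s (iota 0 12), nth 12 s 0 == 0, nth 12 s 10 == 10,
                    nth 12 s 11 == 11
                  & perm_eq (map (relabel s) thirds) thirds])
    relabelings.
Proof. by vm_compute. Qed.

(** Gain 5 means that the classes are met in 2, 1 and 1 points, and the symmetries permute such
    blocks transitively. *)
Lemma first_block_normal :
  all (fun b => if gain cross b == 5
                then any (fun s => relabel s b == first_block) relabelings
                else true)
    candidates.
Proof. by vm_compute. Qed.

(** * Relabelling by the symmetries of the partition *)

Section Relabel.

Variables (p : seq V) (x0 : V) (s : seq nat).
Hypotheses (adm : admissible p) (sR : s \in relabelings).

Definition relabeled := [seq nth x0 p i | i <- s].

Lemma relabel_nth w i : size w = 12 ->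
  i \in [:: 0; 10; 11] -> nth false (relabel s w) i = nth false w i.
Proof.
move=> _; case/and5P: (allP relabelings_spec s sR).
move=> /perm_size szs /eqP s0 /eqP s10 /eqP s11 _.
by rewrite !inE => /or3P[]/eqP->; rewrite (nth_map 12) ?szs // ?s0 ?s10 ?s11.
Qed.

Lemma size_relabel w : size (relabel s w) = 12.
Proof.
case/and5P: (allP relabelings_spec s sR) => /perm_size szs *.
by rewrite size_map szs.
Qed.

Lemma sub_xy_relabel w : size w = 12 -> sub xy (relabel s w) = sub xy w.
Proof. by move=> szw; rewrite !sub_xyE ?size_relabel // !relabel_nth. Qed.

Lemma blocks_relabeled : blocks relabeled B = map (relabel s) (blocks p B).
Proof.
case/and5P: (allP relabelings_spec s sR) => /perm_mem ms *.
rewrite /blocks -map_comp; apply: eq_map => e; apply: bits_relabel => i.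
by rewrite ms mem_iota; case: adm => _ ->.
Qed.

Lemma filter_relabeled (a : pred bitseq) :
    (forall w, size w = 12 -> a (relabel s w) = a w) ->
  [seq w <- blocks relabeled B | a w] =
    map (relabel s) [seq w <- blocks p B | a w].
Proof.
move=> aE; rewrite blocks_relabeled filter_map; congr (map _ _).
by apply: eq_in_filter => w /(blocks_size _) szw; apply/aE/szw; case: adm.
Qed.

Lemma relabeled_admissible : admissible relabeled.
Proof.
case: (adm) => Up szp perm3.
case/and5P: (allP relabelings_spec s sR) => perms _ _ _ permt.
have permp : perm_eq relabeled p.
  rewrite -[X in perm_eq _ X](take_size p) szp.
  by rewrite -(map_nth_iota0 x0) ?szp // perm_map.
split; first by rewrite (perm_uniq permp).
  by rewrite (perm_size permp).
rewrite filter_relabeled; first exact: perm_trans (perm_map _ perm3) permt.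
move=> w szw.
by rewrite !sub_xyz ?size_relabel // sub_xy_relabel // relabel_nth.
Qed.

Lemma lab_relabeled : lab relabeled xy = lab p xy.
Proof.
case: (adm) => _ szp _; case: relabeled_admissible => _ szp' _.
case/and5P: (allP relabelings_spec s sR).
move=> /perm_size szs _ /eqP s10 /eqP s11 _.
by rewrite !(lab_xyE x0) // !(nth_map 12) ?szs // s10 s11.
Qed.

Lemma rest_relabeled : rest relabeled = map (relabel s) (rest p).
Proof.
apply: (@filter_relabeled (fun w => sub xy w && ~~ nth false w 0)) => w szw.
by rewrite sub_xy_relabel // relabel_nth.
Qed.

End Relabel.

(** * Classification of the pairs of degree 9 *)

Lemma normalized_labelling p : admissible p -> size (rest p) = 6 ->
  exists p', [/\ admissible p', lab p' xy = lab p xy & first_block \in rest p'].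
Proof.
move=> adm sz6; have [b bR gb] := rest_big_gain adm sz6.
have := allP first_block_normal b (rest_candidates adm bR).
rewrite gb anyE => /hasP[s sR /eqP sb].
have /card_gt0P[x0 _] : 0 < #|V| by rewrite cardV.
exists (relabeled p x0 s); split.
- exact: relabeled_admissible.
- exact: lab_relabeled.
- by rewrite rest_relabeled //; apply/mapP; exists b.
Qed.

(** [first_block] covers five of the 27, so five blocks face the other 22 and can waste at most
    three. *)
Lemma search_candidates :
  search 5 leaf candidates 5 [:: first_block]
    [seq t <- cross | ~~ sub t first_block].
Proof. by vm_compute. Qed.

Lemma leaf_exists p :
    admissible p -> first_block \in rest p -> size (rest p) = 6 ->
  exists2 ch, leaf ch & perm_eq [seq w <- blocks p B | sub xy w] (thirds ++ ch).
Proof.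
move=> adm fR sz6.
have permR := perm_to_rem fR.
have [||||ch permC lf] :=
  search_complete (rest := rem first_block (rest p)) search_candidates.
- apply/allP => b bC; apply: leq_trans (allP gain_candidates b bC).
  exact/leq_count_subseq/filter_subseq.
- by rewrite size_rem // sz6.
- by move=> b /mem_rem; apply: rest_candidates.
- apply/allP => t; rewrite mem_filter => /andP[tf /(allP (rest_cover adm))].
  by rewrite (eq_has_r (perm_mem permR)) /= (negbTE tf).
exists ch => //; apply: perm_trans (blocks_xy adm) _; rewrite perm_cat2l.
apply: perm_trans permR _.
by rewrite perm_sym (perm_trans permC) // cats1 perm_rcons.
Qed.

Lemma D_uniq : all (fun D => uniq D && (size D == 9)) [:: D0; D1; D2].
Proof. by vm_compute. Qed.

Lemma pair_structure x y : x != y -> deg B [set x; y] = 9 ->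
  (forall v, v \notin [set x; y] -> deg B (v |: [set x; y]) <= 4) /\
  ((forall Q, #|Q| = 4 -> [set x; y] \subset Q -> deg B Q \in [:: 1; 4]) \/
   exists p D, [/\ uniq p, size p = 12, D \in [:: D0; D1; D2]
                 & perm_eq [seq w <- blocks p B | sub xy w] D]).
Proof.
move=> nxy deg9.
have [p0 adm0 lab0] := labelling_exists nxy (eq_leq deg9).
have sz0 : size (rest p0) = 6.
  by move: deg9; rewrite -lab0 (deg_xy adm0) => /(@addnI 3).
have [p [adm labp fR]] := normalized_labelling adm0 sz0.
have {}labp : lab p xy = [set x; y] by rewrite labp.
have szR : size (rest p) = 6.
  by move: deg9; rewrite -labp (deg_xy adm) => /(@addnI 3).
have [ch lf permD] := leaf_exists adm fR szR.
have [Up szp _] := adm; have pT := label_mem Up szp.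
(* A block containing [A] contains the pair, so the nine blocks through the pair determine this
   degree. *)
have degE A : [set x; y] \subset A ->
    deg B A = count (sub (bits p A)) (thirds ++ ch).
  move=> xyA; rewrite -(permP permD) -[in LHS](bitsK A pT) -count_blocks.
  rewrite count_filter; apply: eq_in_count => w wX.
  apply/idP/andP => [Aw|[]//]; split=> //.
  have szw := blocks_size szp wX.
  by apply: (@sub_trans (bits p A)) Aw;
     rewrite ?size_map ?szw ?szp // sub_bits labp.
case/andP: lf => /allP leA leB; split.
  move=> v vxy; rewrite degE ?subsetUr //.
  have iv : index v p < 12 by rewrite -szp index_mem.
  apply: leq_trans (leA (index v p) _); last first.
    rewrite mem_iota leq0n add0n [_ < 10]ltn_neqAle -ltnS.
    rewrite [_ < 11]ltn_neqAle -ltnS iv andbT.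
    move: vxy; rewrite -labp (lab_xyE v szp) !inE negb_or => /andP[v10 v11].
    by apply/and3P; split=> //;
       [apply: contraNneq v10|apply: contraNneq v11] => <-;
       rewrite nth_index.
  set A := v |: [set x; y].
  rewrite (@eq_in_count _ _ (fun w => (size w == 12) && sub (bits p A) w)).
    apply: sub_count => w /andP[/eqP szw vw]; apply: sub_nth vw _.
      by rewrite size_map szp.
    by rewrite (nth_map v) ?szp // nth_index // setU11.
  move=> w; rewrite -(perm_mem permD) mem_filter.
  move=> /andP[_ /(blocks_size szp) ->].
  by rewrite eqxx.
case/orP: leB => [/allP le14|].
  left=> Q cQ xyQ; rewrite degE //; apply: le14.
  rewrite mem_filter sub_bits labp xyQ mem_words size_map szp.
  by rewrite count_bits // cQ.
rewrite anyE => /hasP[s sR]; cbv beta zeta.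
rewrite anyE => /hasP[D DE]; rewrite everyE => /allP DD.
have /card_gt0P[x0 _] : 0 < #|V| by rewrite cardV.
right; exists (relabeled p x0 s), D.
have [Up' szp' _] := relabeled_admissible x0 adm sR.
split => //.
have /andP[UD /eqP szD] := allP D_uniq D DE.
have szL : size (map (relabel s) (thirds ++ ch)) = 9.
  rewrite size_map -(perm_size permD) size_filter -[RHS]deg9 -labp.
  exact: count_blocks.
(* [leaf] gives only an inclusion; equality follows since both sides have nine members and [D] has
   no repetition. *)
have subL : {subset D <= map (relabel s) (thirds ++ ch)}.
  by move=> d /DD; rewrite anyE => /hasP[d' d'D /eqP <-].
have UL := leq_size_uniq UD subL.
rewrite szD szL in UL.
rewrite (filter_relabeled _ adm sR); last by move=> w; apply: sub_xy_relabel.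
apply: perm_trans (perm_map _ permD) _.
apply: uniq_perm => //; first exact: UL.
by move=> d; have [|_ ->] := uniq_min_size UD subL; rewrite ?szL ?szD.
Qed.

(** * Lower bounds on degrees *)

Lemma deg_pair A : #|A| = 2 -> 9 <= deg B A.
Proof.
case/eqP/cards2P=> x [y [nxy ->]].
case: (leqP (deg B [set x; y]) 9) => [le9|/ltnW//].
have [p adm <-] := labelling_exists nxy le9.
by rewrite deg_xy // (leq_add2l 3 6) rest_ge6.
Qed.

Lemma deg_point A : #|A| = 1 -> 20 <= deg B A.
Proof.
(* Rounding up: [99 <= 5 * deg] excludes degree 19. *)
move=> cA; rewrite -(ltn_pmul2l (isT : 0 < 5)).
apply: (@leq_trans (11 * 9)) => //.
have := @deg_lower A 9; rewrite cA; apply=> v vA.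
by apply: deg_pair; rewrite cardsU1 vA cA.
Qed.

Lemma deg_set0 : deg B set0 = #|B|.
Proof. by apply: eq_card => e; rewrite inE sub0set andbT. Qed.

Lemma cover_ge40 : 40 <= #|B|.
Proof.
rewrite -(leq_pmul2l (isT : 0 < 6)) -deg_set0.
have := @deg_lower set0 20; rewrite cards0; apply=> v _.
by apply: deg_point; rewrite setU0 cards1.
Qed.

(** * No covering by 40 blocks *)

Section Forty.

Hypothesis B40 : #|B| = 40.

(** The twelve degrees sum to [6 * 40 = 12 * 20], which leaves no slack. *)
Lemma deg_point_eq A : #|A| = 1 -> deg B A = 20.
Proof.
case/eqP/cards1P=> x ->; apply/eqP; rewrite eqn_leq deg_point ?cards1 // andbT.
have := deg_sum set0 cardB; rewrite deg_set0 B40 cards0 setC0 => sum240.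
rewrite -(leq_add2r (#|[set: V] :\: [set x]| * 20)).
have := @sum_slack _ setT [set x] (fun v => deg B (v |: set0)) 20.
rewrite big_set1 setU0 sum240 subsetT => /(_ isT) slack.
apply: leq_trans (slack _) _ => [v _|].
  by rewrite deg_point // setU0 cards1.
by rewrite cardsDS ?subsetT // cardsT cardV cards1.
Qed.

(** The eleven pairs through [x] have degrees of sum [5 * 20 = 11 * 9 + 1], so at most one of them
    exceeds 9. *)
Lemma deg_pair_eq x y1 y2 : x != y1 -> x != y2 -> y1 != y2 ->
  deg B [set x; y1] = 9 \/ deg B [set x; y2] = 9.
Proof.
move=> xy1 xy2 y12.
case: (ltngtP 9 (deg B [set x; y1])) => [big1|small|->]; last by left.
  case: (ltngtP 9 (deg B [set x; y2])) => [big2|small|->]; last by right.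
    have := deg_sum [set x] cardB; rewrite deg_point_eq ?cards1 // => sum100.
    have := @sum_slack _ (~: [set x]) [set y1; y2]
              (fun v => deg B (v |: [set x])) 9.
    rewrite sum100 big_setU1 ?inE //= big_set1 ![_ |: [set x]]setUC.
    rewrite cardsDS ?cards2 ?y12 ?cardsC1 ?cardV; last first.
      by rewrite subUset !sub1set !inE ![_ == x]eq_sym xy1.
    rewrite subUset !sub1set !inE ![_ == x]eq_sym xy1 xy2 => /(_ isT) slack.
    have /slack : forall u, u \in ~: [set x] :\: [set y1; y2] ->
        9 <= deg B (u |: [set x]).
      move=> u; rewrite !inE => /andP[_ ux].
      by rewrite deg_pair // cards2 ux.
    by move/(leq_trans (leq_add (leq_add big1 big2) (leqnn _))).
  by move: small; rewrite ltnNge deg_pair // cards2 xy2.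
by move: small; rewrite ltnNge deg_pair // cards2 xy1.
Qed.

(** One of two pairs inside [A] with a common point has degree 9, and [pair_structure] bounds the
    triples above it. *)
Lemma deg_triple_le A : #|A| = 3 -> deg B A <= 4.
Proof.
move=> cA; have /card_gt0P[x xA] : 0 < #|A| by rewrite cA.
have /eqP/cards2P[y1 [y2 [y12 Ax]]] : #|A :\ x| = 2.
  by have := cardsD1 x A; rewrite xA cA => -[].
have ny y : y \in A :\ x -> x != y by case/setD1P; rewrite eq_sym.
have [xy1 xy2] : x != y1 /\ x != y2.
  by split; apply: ny; rewrite Ax !inE eqxx ?orbT.
have AE : A = x |: [set y1; y2] by rewrite -Ax setD1K.
have [deg9|deg9] := deg_pair_eq xy1 xy2 y12.
  have [le4 _] := pair_structure xy1 deg9.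
  have -> : A = y2 |: [set x; y1].
    by rewrite AE; apply/setP => v; rewrite !inE orbA orbC.
  by apply: le4; rewrite !inE negb_or [y2 == x]eq_sym xy2 eq_sym.
have [le4 _] := pair_structure xy2 deg9.
have -> : A = y1 |: [set x; y2].
  by rewrite AE; apply/setP => v; rewrite !inE orbCA.
by apply: le4; rewrite !inE negb_or [y1 == x]eq_sym xy1.
Qed.

Lemma lower_deg A k :
  k \in [:: 0; 1; 2; 3; 4] -> #|A| = k -> lower k <= deg B A.
Proof.
rewrite !inE => /or4P[||| /orP[]] /eqP-> cA.
- by rewrite (cards0_eq cA) deg_set0 B40.
- exact: deg_point.
- exact: deg_pair.
- exact: deg_triple.
- exact: coverB.
Qed.

Lemma upper_deg A k : k \in [:: 0; 1; 3] -> #|A| = k -> deg B A <= upper k.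
Proof.
rewrite !inE => /or3P[] /eqP-> cA.
- by rewrite (cards0_eq cA) deg_set0 B40.
- by rewrite deg_point_eq.
- exact: deg_triple_le.
Qed.

Lemma certificates :
  [&& certifies D0 (spread pos0) (spread neg0),
      certifies D1 (spread pos1) (spread neg1)
    & certifies D2 (spread pos2) (spread neg2)].
Proof. by vm_compute. Qed.

Definition star := [seq t <- words 12 4 | nth false t 0].

Lemma size_star : size star = 165.
Proof. by vm_compute. Qed.

(** A block through label 0 contains ['C(5, 3) = 10] quadruples through it. *)
Lemma star_count :
  all (fun w => count (sub^~ w) star == 10 * sub (word [:: 0]) w) (words 12 6).
Proof. by vm_compute. Qed.

(* Modulo 3 the sum of [deg B Q] over the 165 quadruples [Q] through a point is
   [10 * 20 = 2], whereas it would be [165 = 0] if all were 1 or 4. *)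
Lemma quad_exists : exists2 Q : {set V}, #|Q| = 4 & deg B Q \notin [:: 1; 4].
Proof.
pose p := enum V.
have szp : size p = 12 by rewrite -cardE.
have [/allP all14|/allPn[t]] := boolP
  (all (fun t => count (sub t) (blocks p B) \in [:: 1; 4]) star); last first.
  rewrite /star mem_filter mem_words count_blocks.
  move=> /and3P[_ /eqP szt /eqP ct] ndeg.
  by exists (lab p t) => //; rewrite card_lab ?szt ?szp ?enum_uniq.
have : \sum_(t <- star) count (sub t) (blocks p B) = 200.
  rewrite sum_count.
  transitivity (\sum_(w <- blocks p B) 10 * sub (word [:: 0]) w).
    rewrite big_seq [RHS]big_seq; apply: eq_bigr => w wX.
    by apply/eqP/(allP star_count); apply: blocks_words wX; rewrite ?enum_uniq.
  rewrite -big_distrr /=.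
  have -> : \sum_(w <- blocks p B) sub (word [:: 0]) w =
      count (sub (word [:: 0])) (blocks p B).
    rewrite -sum1_count [RHS]big_mkcond.
    by apply: eq_bigr => w _; case: (sub _ w).
  have c1 : #|lab p (word [:: 0])| = 1 by rewrite card_lab ?enum_uniq ?szp.
  by rewrite count_blocks (deg_point_eq c1).
move/(congr1 (modn^~ 3)); rewrite -modn_summ big_seq.
rewrite (eq_bigr (fun=> 1)) => [|t /all14]; last first.
  by rewrite !inE => /orP[]/eqP->.
by rewrite -big_seq sum1_size size_star.
Qed.

Lemma no_cover_40 : False.
Proof.
have [Q cQ ndeg] := quad_exists.
have /card_gt0P[x xQ] : 0 < #|Q| by rewrite cQ.
have cQx : #|Q :\ x| = 3 by have := cardsD1 x Q; rewrite xQ cQ => -[].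
have /card_gt0P[y1 y1Qx] : 0 < #|Q :\ x| by rewrite cQx.
have /card_gt0P[y2] : 0 < #|Q :\ x :\ y1|.
  by have := cardsD1 y1 (Q :\ x); rewrite y1Qx cQx add1n => -[<-].
case/setD1P: y1Qx; rewrite eq_sym => xy1 y1Q.
case/setD1P; rewrite eq_sym => y12 /setD1P[]; rewrite eq_sym => xy2 y2Q.
have [y [xy yQ deg9]] : exists y, [/\ x != y, y \in Q & deg B [set x; y] = 9].
  by have [] := deg_pair_eq xy1 xy2 y12; [exists y1|exists y2].
(* The degree of [Q] excludes the configuration with degrees 1 and 4 only, leaving [D0], [D1] and
   [D2]. *)
have [_ [deg14|[p [D [Up szp DE permD]]]]] := pair_structure xy deg9.
  by move: ndeg; rewrite deg14 // subUset !sub1set xQ yQ.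
have cardT k T : T \in words 12 k -> #|lab p T| = k.
  by rewrite mem_words => /andP[/eqP szT /eqP <-]; rewrite card_lab ?szT.
have lowX k T : k \in [:: 0; 1; 2; 3; 4] -> T \in words 12 k ->
    lower k <= count (sub T) (blocks p B).
  by move=> kP /cardT cT; rewrite count_blocks lower_deg.
have upX k T : k \in [:: 0; 1; 3] -> T \in words 12 k ->
    count (sub T) (blocks p B) <= upper k.
  by move=> kP /cardT cT; rewrite count_blocks upper_deg.
have infeasible pos neg : certifies D pos neg = false.
  apply: negbTE; apply: certifies_infeasible permD lowX upX.
  exact: blocks_words.
have := certificates.
by move: DE; rewrite !inE => /or3P[]/eqP <-; rewrite infeasible ?andbF.
Qed.

End Forty.

Lemma cover_ge41 : 40 < #|B|.
Proof.
rewrite ltn_neqAle cover_ge40 andbT; apply/eqP => B40.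
exact: no_cover_40 (esym B40).
Qed.

End Cover.

(** * Turan systems and hypergraphs without complete subgraphs *)

(* Found by simulated annealing. *)
Definition system41 : seq bitseq := map word [::
  [:: 0; 1; 2; 3; 5; 9]; [:: 0; 1; 2; 3; 6; 11]; [:: 0; 1; 2; 4; 7; 8];
  [:: 0; 1; 2; 6; 9; 10]; [:: 0; 1; 3; 4; 7; 10]; [:: 0; 1; 3; 5; 8; 11];
  [:: 0; 1; 4; 5; 6; 7]; [:: 0; 1; 4; 7; 9; 11]; [:: 0; 1; 5; 8; 9; 10];
  [:: 0; 1; 6; 8; 10; 11]; [:: 0; 2; 3; 4; 5; 11]; [:: 0; 2; 3; 7; 8; 10];
  [:: 0; 2; 4; 5; 9; 10]; [:: 0; 2; 4; 6; 10; 11]; [:: 0; 2; 5; 6; 7; 8];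
  [:: 0; 2; 7; 8; 9; 11]; [:: 0; 3; 4; 6; 8; 9]; [:: 0; 3; 5; 6; 7; 10];
  [:: 0; 3; 7; 9; 10; 11]; [:: 0; 4; 5; 8; 10; 11]; [:: 0; 5; 6; 7; 9; 11];
  [:: 1; 2; 3; 4; 8; 10]; [:: 1; 2; 3; 5; 7; 11]; [:: 1; 2; 4; 5; 6; 8];
  [:: 1; 2; 4; 8; 9; 11]; [:: 1; 2; 5; 7; 9; 10]; [:: 1; 2; 6; 7; 10; 11];
  [:: 1; 3; 4; 5; 6; 10]; [:: 1; 3; 4; 9; 10; 11]; [:: 1; 3; 6; 7; 8; 9];
  [:: 1; 4; 5; 6; 9; 11]; [:: 1; 5; 7; 8; 10; 11]; [:: 2; 3; 4; 6; 7; 9];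
  [:: 2; 3; 5; 6; 8; 10]; [:: 2; 3; 8; 9; 10; 11]; [:: 2; 4; 5; 7; 10; 11];
  [:: 2; 5; 6; 8; 9; 11]; [:: 3; 4; 5; 7; 8; 9]; [:: 3; 4; 6; 7; 8; 11];
  [:: 3; 5; 6; 9; 10; 11]; [:: 4; 6; 7; 8; 9; 10]].

Lemma system41_spec :
  [&& all (fun w => w \in words 12 6) system41, size system41 == 41
    & all (fun L => has (sub^~ L) system41) (words 12 8)].
Proof. by vm_compute. Qed.

(** Complementation reverses inclusion, preserves size 6 and exchanges 8-sets with 4-sets. *)
Lemma turan_system_ge41 (S : {set {set 'I_12}}) :
  turan_system 8 6 S -> 41 <= #|S|.
Proof.
case/andP=> /forall_inP S6 /forallP S8.
rewrite -(card_imset _ (@setC_inj 'I_12)).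
apply: cover_ge41; first exact: card_ord.
  move=> _ /imsetP[e eS ->].
  by rewrite cardsCs setCK card_ord (eqP (S6 e eS)).
move=> Q cQ; have := S8 (~: Q).
rewrite cardsCs setCK card_ord cQ => /exists_inP[e eS eQ].
apply/card_gt0P; exists (~: e); rewrite inE imset_f //=.
by rewrite -setCS setCK.
Qed.

Lemma turan_system41 :
  exists2 S : {set {set 'I_12}}, turan_system 8 6 S & #|S| <= 41.
Proof.
pose p := enum 'I_12; have Up : uniq p by apply: enum_uniq.
have szp : size p = 12 by rewrite size_enum_ord.
have pT v : v \in p by rewrite mem_enum.
case/and3P: system41_spec => /allP S6 /eqP sz41 /allP S8.
exists [set e in map (lab p) system41]; last first.
  by rewrite cardsE (leq_trans (card_size _)) // size_map sz41.
apply/andP; split.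
  apply/forall_inP => e; rewrite inE => /mapP[w /S6 + ->].
  rewrite mem_words => /andP[/eqP szw cw].
  by rewrite card_lab ?szw ?szp.
apply/forallP => L; apply/implyP => /eqP cL.
have /hasP[w wS wL] : has (sub^~ (bits p L)) system41.
  by apply: S8; rewrite mem_words size_map szp count_bits ?cL.
apply/exists_inP; exists (lab p w); first by rewrite inE map_f.
by rewrite -sub_bits.
Qed.

Lemma card_complete n k : #|complete_hypergraph k n| = 'C(n, k).
Proof. by rewrite card_draws card_ord. Qed.

Lemma contains_completeP n k l (H : {set {set 'I_n}}) :
  reflect (exists2 L : {set 'I_n}, #|L| = l &
             forall e : {set 'I_n}, e \subset L -> #|e| = k -> e \in H)
          (contains_copy (complete_hypergraph k l) H).
Proof.
apply: (iffP existsP).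
  move=> [f /andP[/injectiveP f_inj /forall_inP fH]].
  exists (f @: setT); first by rewrite card_imset // cardsT card_ord.
  (* A subset of the image of [f] is the image of its preimage, which has the same size by
     injectivity. *)
  move=> e /subsetP ef ce; have eE : f @: (f @^-1: e) = e.
    apply/setP => v; apply/imsetP/idP => [[i + ->]|ve]; first by rewrite inE.
    by have /imsetP[i _ vE] := ef v ve; exists i; rewrite // inE -vE.
  by rewrite -eE; apply: fH; rewrite inE -(card_imset _ f_inj) eE ce.
move=> [L cL LH]; have szL : size (enum L) == l by rewrite -cardE cL.
pose f := [ffun i : 'I_l => tnth (Tuple szL) i].
have f_inj : injective f.
  move=> i j; rewrite !ffunE; move: i j; apply/tuple_uniqP.
  exact: enum_uniq.
exists f; apply/andP; split; first exact/injectiveP.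
apply/forall_inP => a; rewrite inE => /eqP ca.
apply: LH; last by rewrite card_imset.
apply/subsetP => _ /imsetP[i _ ->].
by rewrite ffunE -mem_enum mem_tnth.
Qed.

(** An [l]-set containing no non-edge would span a copy in [H]. *)
Lemma free_turan_system n k l (H : {set {set 'I_n}}) :
    ~~ contains_copy (complete_hypergraph k l) H ->
  turan_system l k (complete_hypergraph k n :\: H).
Proof.
move=> Hfree; apply/andP; split.
  by apply/forall_inP => e; rewrite !inE => /andP[].
apply/forallP => L; apply/implyP => /eqP cL.
apply: contraR Hfree => /exists_inPn noL; apply/contains_completeP.
exists L => // e eL ce; apply: contraLR eL => eH; apply: noL.
by rewrite !inE eH ce eqxx.
Qed.

Lemma turan_system_free n k l (S : {set {set 'I_n}}) : turan_system l k S ->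
  ~~ contains_copy (complete_hypergraph k l) (complete_hypergraph k n :\: S).
Proof.
case/andP=> /forall_inP Sk /forallP Sl; apply/contains_completeP => -[L cL LS].
have := Sl L; rewrite cL eqxx => /exists_inP[e eS eL].
by have := LS e eL (eqP (Sk e eS)); rewrite inE eS.
Qed.

Theorem corollary16 :
  turan_number 12 8 6 = 41 /\
  (ex_number 12 6 (complete_hypergraph 6 8) = 924 - 41 /\ 924 - 41 = 883).
Proof.
have [S sysS cS] := turan_system41.
(* The explicit list gives only [<=]; the lower bound makes it an equality. *)
have {}cS : #|S| = 41 by apply/eqP; rewrite eqn_leq cS turan_system_ge41.
split; last split=> //.
  have [[S' sysS' <-] least] := @turan_number_least 12 8 6 isT.
  by apply/eqP; rewrite eqn_leq turan_system_ge41 // andbT -cS least.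
have c924 : #|complete_hypergraph 6 12| = 924 by rewrite card_complete.
apply/eqP; rewrite eqn_leq; apply/andP; split.
  (* The 6-sets outside [H] form a Turan system, so there are at least 41 of them. *)
  apply/bigmax_leqP => H /andP[H6 Hfree].
  rewrite -c924 leq_subRL; last by rewrite c924.
  have subH : H \subset complete_hypergraph 6 12.
    by apply/subsetP => e /(forall_inP H6); rewrite inE.
  rewrite addnC -(cardsID H (complete_hypergraph 6 12)) (setIidPr subH).
  rewrite leq_add2l.
  by apply: turan_system_ge41; apply: free_turan_system.
(* The 6-sets outside [S] attain the bound. *)
have subS : S \subset complete_hypergraph 6 12.
  by apply/subsetP => e eS; rewrite inE; case/andP: sysS => /forall_inP->.
have -> : 924 - 41 = #|complete_hypergraph 6 12 :\: S|.
  by rewrite cardsDS // c924 cS.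
apply: (leq_bigmax_cond (P := fun H => uniform 6 H && _)).
rewrite turan_system_free // andbT.
by apply/forall_inP => e; rewrite !inE => /andP[].
Qed.
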